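(* Let $M$ be a compact Riemannian manifold and $N$ a compact metric space with distance $d_N$. Let $F:M\times N\to M\times N$, $F(x,y)=(f(x),g(x,y))$, where $f:M\to M$ is a $C^1$ local diffeomorphism and $g:M\times N\to N$ is continuous, there is $0<\lambda<1$ with $d_N(g(x,y_1),g(x,y_2))\le\lambda\,d_N(y_1,y_2)$ for all $x\in M$, $y_1,y_2\in N$, and there is $y_0\in N$ with $g(x,y_0)=y_0$ for every $x\in M$. Let $\phi:M\times N\to\mathbb R$ be a Hölder continuous potential and let $c>0$. Then there exists a Hölder continuous potential $\bar\phi:M\times N\to\mathbb R$ not depending on the stable direction (i.e. $\bar\phi(x,y)=\bar\phi(x,y')$ for all $x\in M$, $y,y'\in N$) such that: (1) $\bar\phi$ is homologous to $\phi$; (2) if $\phi$ is $c$-hyperbolic for $F$, then $\bar\phi$ is $c$-hyperbolic for $F$; (3) $P_F(\bar\phi)=P_F(\phi)$; (4) $(F,\phi)$ and $(F,\bar\phi)$ have the same equilibrium states.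
   Context: $M\times N$ carries the product distance (e.g. the maximum of the two distances). Two potentials $\bar\phi,\phi:M\times N\to\mathbb R$ are homologous if there is a continuous $u:M\times N\to\mathbb R$ such that $\bar\phi=\phi-u+u\circ F$. Equilibrium state: for a continuous map $T:X\to X$ of a compact metric space and a continuous potential $\phi:X\to\mathbb R$, a $T$-invariant Borel probability $\mu$ is an equilibrium state for $(T,\phi)$ if $h_\mu(T)+\int\phi\,d\mu=\sup_\eta\{h_\eta(T)+\int\phi\,d\eta\}$, the supremum being over all $T$-invariant Borel probabilities $\eta$ on $X$. Relative pressure: let $X$ be a compact metric space, $T:X\to X$ and $\phi:X\to\mathbb R$ continuous. For $\delta>0$, $n\in\mathbb N$, $x\in X$ let $B_\delta(x,n)=\{y\in X: d(T^j(x),T^j(y))<\delta \text{ for } 0\le j\le n\}$, $S_n\phi=\sum_{j=0}^{n-1}\phi\circ T^j$ and $R_{n,\delta}\phi(x)=\sup_{y\in B_\delta(x,n)}S_n\phi(y)$. For $\Lambda\subset X$, $L\in\mathbb N$ and $\gamma\in\mathbb R$ let $m_T(\phi,\Lambda,\delta,L,\gamma)=\inf_{\mathcal U}\sum_{B_\delta(x,n)\in\mathcal U}e^{-\gamma n+R_{n,\delta}\phi(x)}$, the infimum over all finite or countable families $\mathcal U$ of dynamic balls $B_\delta(x,n)$ with $x\in X$, $n\ge L$, covering $\Lambda$. Put $m_T(\phi,\Lambda,\delta,\gamma)=\lim_{L\to\infty}m_T(\phi,\Lambda,\delta,L,\gamma)$, $P_T(\phi,\Lambda,\delta)=\inf\{\gamma: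 m_T(\phi,\Lambda,\delta,\gamma)=0\}$, and $P_T(\phi,\Lambda)=\lim_{\delta\to0}P_T(\phi,\Lambda,\delta)$. The topological pressure is $P_T(\phi)=P_T(\phi,X)$; by the variational principle it equals $\sup_\eta\{h_\eta(T)+\int\phi\,d\eta\}$ over $T$-invariant Borel probabilities $\eta$. Hyperbolic potentials: $\Sigma_c(f)$ is the set of $x\in M$ with $\limsup_{n\to\infty}\frac1n\sum_{j=0}^{n-1}\log\|Df(f^j(x))^{-1}\|\le -c$. A continuous $\phi:M\times N\to\mathbb R$ is a $c$-hyperbolic potential for $F$ if $P_F(\phi,(M\setminus\Sigma_c(f))\times N)<P_F(\phi,\Sigma_c(f)\times N)=P_F(\phi)$. *)

(* Defs.v *)
From HB Require Import structures.
From mathcomp Require Import all_boot all_order all_algebra.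
From mathcomp Require Import all_classical all_reals all_analysis.

Set Implicit Arguments.
Unset Strict Implicit.
Unset Printing Implicit Defensive.

Import Order.TTheory GRing.Theory Num.Theory.
Import numFieldNormedType.Exports.
Import numFieldTopology.Exports.

Local Open Scope classical_set_scope.
Local Open Scope ring_scope.

(* The base point only serves to form Borel probabilities, because the library
   requires measurable types to be pointed; it has no other role. *)
#[short(type="pmetricType")]
HB.structure Definition PointedMetric (K : numDomainType) :=
  { M of Pointed M & Metric K M }.

Section product_metric.
Context {R : realType} {M N : metricType R}.

Definition prod_mdist (p q : M * N) : R :=
  Num.max (mdist p.1 q.1) (mdist p.2 q.2).

Let prod_mdist_ge0 p q : 0 <= prod_mdist p q.
Proof. by rewrite /prod_mdist le_max mdist_ge0. Qed.

Let prod_mdist_positivity p q : prod_mdist p q = 0 -> p = q.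
Proof.
case: p q => [x y] [x' y']; rewrite /prod_mdist/= => pq0.
have le0 a : a <= Num.max (mdist x x') (mdist y y') -> a <= 0 by rewrite pq0.
congr pair; apply: mdist_positivity; apply/eqP; rewrite eq_le mdist_ge0 andbT;
  by apply: le0; rewrite le_max lexx ?orbT.
Qed.

Let prod_ballEmdist p e : ball p e = [set q | prod_mdist p q < e].
Proof.
apply/seteqP; split => q; rewrite /= /prod_mdist gt_max.
  by move=> [] /=; rewrite !ballEmdist/= => -> ->.
by move=> /andP[? ?]; split; rewrite ballEmdist.
Qed.

HB.instance Definition _ := @PseudoMetric_isMetric.Build R (M * N)%type
  prod_mdist prod_mdist_ge0 prod_mdist_positivity prod_ballEmdist.

End product_metric.

HB.instance Definition _ (R : realType) (M N : pmetricType R) :=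
  Pointed.on (M * N)%type.

Section manifolds.
Context {R : realType}.

(* [U] is meant to be open *)
Fixpoint Ck_on {V W : normedModType R} (k : nat) (U : set V) (f : V -> W) :
    Prop :=
  if k is k'.+1 then
    (forall x, U x -> differentiable f x) /\ forall v, Ck_on k' U ('D_v f)
  else forall x, U x -> {for x, continuous f}.

Definition smooth_on {V W : normedModType R} (U : set V) (f : V -> W) :=
  forall k, Ck_on k U f.

(* [chart_fun] and [chart_inv] are meaningful only on [chart_dom] and on its
   image. *)
Record chart (n : nat) (M : topologicalType) := Chart {
  chart_dom : set M ;
  chart_fun : M -> 'rV[R]_n ;
  chart_inv : 'rV[R]_n -> M ;
  chart_dom_open : open chart_dom ;
  chart_img_open : open (chart_fun @` chart_dom) ;
  chart_funK : forall x, chart_dom x -> chart_inv (chart_fun x) = x ;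
  chart_fun_continuous :
    forall x, chart_dom x -> {for x, continuous chart_fun} ;
  chart_inv_continuous :
    forall x, chart_dom x -> {for chart_fun x, continuous chart_inv} }.

(* Charts take values in all of R^n, so manifolds have no boundary. The tangent
   space at [x] is 'rV[R]_n, read in the preferred chart [chart_at x]. *)
Record smooth_atlas (n : nat) (M : topologicalType) := SmoothAtlas {
  atlas : set (chart n M) ;
  chart_at : M -> chart n M ;
  chart_at_atlas : forall x, atlas (chart_at x) ;
  chart_at_dom : forall x, chart_dom (chart_at x) x ;
  atlas_smooth : forall c c', atlas c -> atlas c' ->
    smooth_on (chart_fun c @` (chart_dom c `&` chart_dom c'))
              (chart_fun c' \o chart_inv c) }.

(* [gram c x] is the Gram matrix at [x] of the metric tensor in the coordinates
   of [c]. Jacobian matrices act on row vectors from the right. *)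
Record riemannian_tensor (n : nat) (M : topologicalType)
    (A : smooth_atlas n M) := RiemannianTensor {
  gram : chart n M -> M -> 'M[R]_n ;
  gram_sym : forall c x, atlas A c -> chart_dom c x -> (gram c x)^T = gram c x ;
  gram_posdef : forall c x (v : 'rV[R]_n), atlas A c -> chart_dom c x ->
    v != 0 -> 0 < (v *m gram c x *m v^T) 0 0 ;
  gram_transition : forall c c' x, atlas A c -> atlas A c' ->
    chart_dom c x -> chart_dom c' x ->
    let J := 'J (chart_fun c' \o chart_inv c) (chart_fun c x) in
    gram c x = J *m gram c' x *m J^T ;
  gram_smooth : forall c, atlas A c ->
    smooth_on (chart_fun c @` chart_dom c) (gram c \o chart_inv c) }.

Section smooth_manifold.
Context {n : nat} {M : topologicalType} (A : smooth_atlas n M).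

(* [U] is meant to be open *)
Definition C1_map_on (U : set M) (h : M -> M) : Prop :=
  (forall x, U x -> {for x, continuous h}) /\
  forall c c', atlas A c -> atlas A c' ->
    Ck_on 1 (chart_fun c @` (chart_dom c `&` U `&` h @^-1` chart_dom c'))
            (chart_fun c' \o h \o chart_inv c).

Definition C1_local_diffeo (f : M -> M) : Prop :=
  forall x, exists (U V : set M) (h : M -> M),
    [/\ open U /\ U x, open V,
        (forall z, U z -> V (f z) /\ h (f z) = z),
        (forall z, V z -> U (h z) /\ f (h z) = z) &
        C1_map_on U f /\ C1_map_on V h].

(* A C^1 curve on [0, 1] extends to a C^1 curve on the whole line, so curves
   are parametrized by R. *)
Definition C1_curve (gamma : R -> M) : Prop :=
  continuous gamma /\
  forall c, atlas A c ->
    Ck_on 1 (gamma @^-1` chart_dom c) (chart_fun c \o gamma).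

(* Df(x) : T_x M -> T_{f(x)} M, in the preferred charts at x and f(x) *)
Definition tangent_mx (f : M -> M) (x : M) : 'M[R]_n :=
  'J (chart_fun (chart_at A (f x)) \o f \o chart_inv (chart_at A x))
     (chart_fun (chart_at A x) x).

Context (G : riemannian_tensor A).

Definition tnorm (x : M) (v : 'rV[R]_n) : R :=
  Num.sqrt ((v *m gram G (chart_at A x) x *m v^T) 0 0).

Definition curve_length (gamma : R -> M) : \bar R :=
  (\int[lebesgue_measure]_(t in `[0%R, 1%R])
    (tnorm (gamma t) (derive1 (chart_fun (chart_at A (gamma t)) \o gamma) t))%:E)%E.

(* the norm || Df(x)^{-1} || of Df(x)^{-1} : T_{f(x)} M -> T_x M *)
Definition norm_Dinv (f : M -> M) (x : M) : R :=
  sup [set tnorm x (w *m invmx (tangent_mx f x)) | w in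
       [set w : 'rV[R]_n | tnorm (f x) w <= 1]].

(* [lne 0 = -oo] is only reached when dim M = 0 *)
Definition Sigma_c (f : M -> M) (c : R) : set M :=
  [set x | (limn_esup (fun k : nat =>
      (k%:R^-1)%:E * \sum_(j < k) lne (norm_Dinv f (iter j f x))%:E)
    <= (- c)%:E)%E].

End smooth_manifold.

(* The distance of M is the infimum of the lengths of the curves joining two
   points. If M is not connected, this leaves the distance between points of
   distinct components free. *)
Definition riemannian_distance {n : nat} {M : metricType R}
    {A : smooth_atlas n M} (G : riemannian_tensor A) : Prop :=
  forall x y : M,
    let joining := [set gamma | [/\ C1_curve A gamma, gamma 0 = x & gamma 1 = y]]
    in joining !=set0 ->
    (mdist x y)%:E = ereal_inf [set curve_length G gamma | gamma in joining].

End manifolds.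

Definition holder_continuous {R : realType} {X : metricType R} (phi : X -> R) :
    Prop :=
  exists C alpha : R, [/\ 0 < alpha, alpha <= 1 &
    forall p q, `|phi p - phi q| <= C * mdist p q `^ alpha].

Definition homologous {R : realType} {X : topologicalType} (T : X -> X)
    (phib phi : X -> R) : Prop :=
  exists u : X -> R, continuous u /\
    forall p, phib p = phi p - u p + u (T p).

Notation borel X := (g_sigma_algebraType (@open X)).

Section entropy.
Context {R : realType} {X : pmetricType R}.

Context (T : X -> X).

Definition invariant (mu : probability (borel X) R) : Prop :=
  forall B : set (borel X), measurable B -> mu (T @^-1` B) = mu B.

(* Finite measurable partitions are coded by labellings xi : X -> 'I_k; a word
   w of length m then names an atom of the join of the T^{-j} xi, j < m. *)
Definition atom {k m : nat} (xi : X -> 'I_k) (w : {ffun 'I_m -> 'I_k}) :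
    set (borel X) :=
  [set x | forall j : 'I_m, xi (iter j T x) = w j].

(* [ln 0 = 0] in the library, in accordance with 0 log 0 = 0 *)
Definition join_entropy {k : nat} (mu : probability (borel X) R) (xi : X -> 'I_k)
    (m : nat) : R :=
  \sum_(w : {ffun 'I_m -> 'I_k})
    - (fine (mu (atom xi w)) * ln (fine (mu (atom xi w)))).

Definition partition_entropy {k : nat} (mu : probability (borel X) R)
    (xi : X -> 'I_k) : \bar R :=
  limn (fun m => (join_entropy mu xi m / m%:R)%:E).

Definition metric_entropy (mu : probability (borel X) R) : \bar R :=
  ereal_sup [set h | exists (k : nat) (xi : X -> 'I_k),
    (forall i, measurable (xi @^-1` [set i] : set (borel X))) /\
    h = partition_entropy mu xi].

Definition free_energy (phi : X -> R) (mu : probability (borel X) R) : \bar R :=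
  (metric_entropy mu + \int[mu]_x (phi x)%:E)%E.

Definition equilibrium_state (phi : X -> R) (mu : probability (borel X) R) : Prop :=
  invariant mu /\
  free_energy phi mu = ereal_sup [set free_energy phi eta | eta in invariant].

End entropy.

Section pressure.
Context {R : realType} {X : metricType R} (T : X -> X) (phi : X -> R).

Definition dyn_ball (delta : R) (x : X) (k : nat) : set X :=
  [set y | forall j : nat, (j <= k)%N ->
     mdist (iter j T x) (iter j T y) < delta].

Definition birkhoff_sum (k : nat) (x : X) : R :=
  \sum_(0 <= j < k) phi (iter j T x).

Definition R_sup (k : nat) (delta : R) (x : X) : R :=
  sup [set birkhoff_sum k y | y in dyn_ball delta x k].

(* a family of dynamic balls B_delta(x, k) is given by the set of its (x, k) *)
Definition ball_covers (Lambda : set X) (delta : R) (L : nat) :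
    set (set (X * nat)) :=
  [set U | [/\ countable U, (forall b, U b -> (L <= b.2)%N) &
    Lambda `<=` \bigcup_(b in U) dyn_ball delta b.1 b.2]].

Definition m_cover_from (Lambda : set X) (delta : R) (L : nat) (gamma : R) :
    \bar R :=
  ereal_inf [set (\esum_(b in U)
      (expR (- (gamma * b.2%:R) + R_sup b.2 delta b.1))%:E)%E |
    U in ball_covers Lambda delta L].

Definition m_cover (Lambda : set X) (delta : R) (gamma : R) : \bar R :=
  limn (fun L => m_cover_from Lambda delta L gamma).

Definition pressure_at_scale (Lambda : set X) (delta : R) : \bar R :=
  ereal_inf [set gamma%:E | gamma in
    [set gamma : R | m_cover Lambda delta gamma = 0%E]].

Definition relative_pressure (Lambda : set X) : \bar R :=
  lim (pressure_at_scale Lambda delta @[delta --> 0^'+]).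

Definition pressure : \bar R := relative_pressure [set: X].

End pressure.

Definition skew_product {M N : Type} (f : M -> M) (g : M * N -> N) :
    M * N -> M * N := fun p => (f p.1, g p).

Definition hyperbolic_potential {R : realType} {n : nat} {M N : metricType R}
    {A : smooth_atlas n M} (G : riemannian_tensor A)
    (f : M -> M) (F : M * N -> M * N) (c : R) (phi : M * N -> R) : Prop :=
  [/\ continuous phi,
      (relative_pressure F phi (~` Sigma_c G f c `*` [set: N])
        < relative_pressure F phi (Sigma_c G f c `*` [set: N]))%E &
      relative_pressure F phi (Sigma_c G f c `*` [set: N]) = pressure F phi].

(* Main.v *)
Require Import Defs.
From mathcomp Require Import all_boot all_order all_algebra.
From mathcomp Require Import all_classical all_reals all_analysis.
From mathcomp Require Import ring.

Set Implicit Arguments.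
Unset Strict Implicit.
Unset Printing Implicit Defensive.

Import Order.TTheory GRing.Theory Num.Theory.
Import numFieldNormedType.Exports.

Local Open Scope classical_set_scope.
Local Open Scope ring_scope.

(** Every forward orbit is exponentially close to the forward orbit, over the
    same base point, that lies in the invariant section [y = y0]: the fibre
    coordinates of [F^j (x, y)] and of [F^j (x, y0) = (f^j x, y0)] are at
    distance at most [lambda^j * diam N]. Hence, with
    [phib (x, y) = phi (x, y0)], the gap [psi = phi - phib] satisfies
    [|psi (F^j p)| <= |C| * (lambda^j * diam N)^alpha], where [C] and [alpha]
    are the Holder constant and exponent of [phi]; this is summable in [j]
    uniformly in [p] ([fibre_gap_summable]). The series
    [u = sum_j psi \o F^j] then converges to a continuous function, and
    shifting it by one step gives [psi = u - u \o F]
    ([coboundary_of_summable_orbit]), so that [phib = phi - u + u \o F]. The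
    potential [phib] is constant along the fibres, and it is Holder because
    it is the composition of [phi] with a 1-Lipschitz map.

    The other claims hold for any two continuous potentials cohomologous
    through a bounded continuous [u]. The Birkhoff sums telescope, so they
    differ by at most [2 * sup |u|] whatever their length; this multiplies the
    weights in the definition of the relative pressure by a factor bounded
    above and below, which does not affect whether the covering sums tend to
    [0]. The relative pressures of every subset therefore coincide
    ([relative_pressure_cohomologous]), and hyperbolicity and the topological
    pressure only depend on relative pressures. Finally [u - u \o F] has
    integral [0] for every invariant measure, so the two potentials have the
    same free energy at each of them ([free_energy_cohomologous]), hence the
    same equilibrium states. *)

(** * Relative pressure of cohomologous potentials *)

(** A set that is empty or unbounded above has supremum [0] by convention. Both
    defects are shared by the images under two functions at bounded distance,
    so the estimate survives these default values. *)
Lemma sup_image_close (R : realType) (T : Type) (S : set T) (a b : T -> R)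
    (K : R) : 0 <= K -> (forall y, `|a y - b y| <= K) ->
  sup [set a y | y in S] <= sup [set b y | y in S] + K.
Proof.
move=> K0 abK.
have ab y : a y <= b y + K.
  by rewrite -lerBlDl (le_trans (ler_norm _))// abK.
have ba y : b y <= a y + K.
  by rewrite -lerBlDl (le_trans (ler_norm _))// distrC abK.
have [[[_ [y0 Sy0 _]] ubb]|hb] := pselect (has_sup [set b y | y in S]).
  apply: ge_sup; first by exists (a y0), y0.
  move=> _ [y Sy <-]; rewrite (le_trans (ab y))// lerD2r.
  by apply: ub_le_sup => //; exists y.
rewrite (sup_out hb) sup_out ?add0r// => -[[_ [y0 Sy0 _]] [z uba]].
apply: hb; split; first by exists (b y0), y0.
exists (z + K) => _ [y Sy <-]; rewrite (le_trans (ba y))// lerD2r.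
by apply: uba; exists y.
Qed.

Lemma le_esum_scale (R : realType) (I : choiceType) (S : set I)
    (a b : I -> \bar R) (r : R) : 0 <= r ->
  (forall i, (0 <= b i)%E) -> (forall i, (a i <= r%:E * b i)%E) ->
  (\esum_(i in S) a i <= r%:E * \esum_(i in S) b i)%E.
Proof.
move=> r0 b0 ab; apply: ge_ereal_sup => _ [X SX <-].
have finX : finite_set X by case: SX.
apply: (@le_trans _ _ (\sum_(i \in X) (r%:E * b i))%E).
  by apply: lee_fsum => // i _; exact: ab.
rewrite -ge0_mule_fsumr// lee_pmul ?lee_fin//.
  by apply: fsume_ge0.
by apply: esum_ge; exists X.
Qed.

Section pressure_cohomology.
Context {R : realType} {X : metricType R} (T : X -> X).

Lemma birkhoff_sum_coboundary (phi psi u : X -> R) (k : nat) (x : X) :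
  (forall p, psi p = phi p - u p + u (T p)) ->
  birkhoff_sum T psi k x = birkhoff_sum T phi k x - u x + u (iter k T x).
Proof.
move=> psiE; elim: k => [|k IH].
  by rewrite /birkhoff_sum !big_geq// sub0r /= addNr.
move: IH; rewrite /birkhoff_sum !big_nat_recr//= => ->.
by rewrite psiE; ring.
Qed.

Lemma m_cover_from_ge0 (chi : X -> R) Lambda delta L gamma :
  (0 <= m_cover_from T chi Lambda delta L gamma)%E.
Proof.
apply/ereal_infP => _ [U _ <-]; apply: esum_ge0 => b _.
by rewrite lee_fin expR_ge0.
Qed.

(** A change of at most [K] in all Birkhoff sums costs a factor at most
    [expR K] in the weight of every dynamic ball, hence in every covering
    sum. *)
Lemma m_cover_from_close (phi psi : X -> R) (K : R) Lambda delta L gamma :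
  0 <= K ->
  (forall k x, `|birkhoff_sum T psi k x - birkhoff_sum T phi k x| <= K) ->
  (m_cover_from T psi Lambda delta L gamma <=
   (expR K)%:E * m_cover_from T phi Lambda delta L gamma)%E.
Proof.
move=> K0 close.
rewrite -ereal_inf_pZl ?expR_gt0//; apply/ereal_infP => _ [_ [U UL <-] <-].
apply: (@le_trans _ _ (\esum_(b in U)
    (expR (- (gamma * b.2%:R) + R_sup T psi b.2 delta b.1))%:E)%E).
  by apply: ereal_inf_lbound; exists U.
apply: le_esum_scale => [|b|b]; rewrite ?expR_ge0 ?lee_fin ?expR_ge0//.
rewrite -expRD ler_expR addrCA lerD2l addrC.
exact: sup_image_close.
Qed.

(** Fewer families are admissible as the minimal length [L] grows, so
    [m_cover] is the supremum over [L] of nonnegative quantities. *)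
Lemma m_cover_eq0 (chi : X -> R) Lambda delta gamma :
  m_cover T chi Lambda delta gamma = 0%E <->
  forall L, m_cover_from T chi Lambda delta L gamma = 0%E.
Proof.
have mono : {homo (fun L => m_cover_from T chi Lambda delta L gamma) :
    m n / (m <= n)%N >-> (m <= n)%E}.
  move=> m n mn; apply: ereal_inf_le_tmp => _ [U [cU nU covU] <-].
  exists U => //; by split=> // b /nU; exact: leq_trans.
have limE := cvg_lim (@ereal_hausdorff R) (ereal_nondecreasing_cvgn mono).
rewrite /m_cover limE; split=> [sup0 L|all0].
  apply/eqP; rewrite eq_le m_cover_from_ge0 andbT -sup0.
  by apply: ereal_sup_ubound; exists L.
rewrite [X in ereal_sup X](_ : _ = [set 0%E]) ?ereal_sup1//.
apply/seteqP; split=> [_ [L _ <-]|_ ->] /=; first exact: all0.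
by exists 0%N.
Qed.

Lemma relative_pressure_close (phi psi : X -> R) (K : R) (Lambda : set X) :
  0 <= K ->
  (forall k x, `|birkhoff_sum T psi k x - birkhoff_sum T phi k x| <= K) ->
  relative_pressure T psi Lambda = relative_pressure T phi Lambda.
Proof.
move=> K0 close.
have imp (a b : X -> R) delta gamma :
    (forall k x, `|birkhoff_sum T a k x - birkhoff_sum T b k x| <= K) ->
    m_cover T b Lambda delta gamma = 0%E ->
    m_cover T a Lambda delta gamma = 0%E.
  move=> ab /m_cover_eq0 b0; apply/m_cover_eq0 => L; apply/eqP.
  rewrite eq_le m_cover_from_ge0 andbT.
  by rewrite (le_trans (m_cover_from_close _ _ _ _ K0 ab))// b0 mule0.
have scaleE : pressure_at_scale T psi Lambda = pressure_at_scale T phi Lambda.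
  apply/funext => delta.
  apply: (congr1 (fun S : set R => ereal_inf [set gamma%:E | gamma in S])).
  apply/seteqP; split=> gamma; apply: imp => // k x.
  by rewrite distrC.
by rewrite /relative_pressure scaleE.
Qed.

Lemma relative_pressure_cohomologous (phi psi u : X -> R) (K : R)
    (Lambda : set X) :
  0 <= K -> (forall p, psi p = phi p - u p + u (T p)) ->
  (forall p, `|u p| <= K) ->
  relative_pressure T psi Lambda = relative_pressure T phi Lambda.
Proof.
move=> K0 psiE uK; apply: (@relative_pressure_close _ _ (K + K)) => [|k x].
  by rewrite addr_ge0.
rewrite (birkhoff_sum_coboundary _ _ psiE).
set s := birkhoff_sum _ _ _ _; set v := u (iter _ _ _).
have -> : s - u x + v - s = v - u x by ring.
by rewrite (le_trans (ler_normB _ _))// lerD// /v uK.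
Qed.

End pressure_cohomology.

(** * Free energy of cohomologous potentials *)

Lemma compact_continuous_bounded (R : realType) (X : topologicalType)
    (u : X -> R) : compact [set: X] -> continuous u ->
  exists2 K, 0 <= K & forall x, `|u x| <= K.
Proof.
move=> Xc uc.
have /compact_bounded [K [_ bK]] : compact [set u x | x in [set: X]].
  by apply: continuous_compact => //; exact: continuous_subspaceT.
exists (`|K| + 1); first by rewrite addr_ge0.
move=> x; apply: bK; last by exists x.
by rewrite (le_lt_trans (ler_norm K))// ltrDl.
Qed.

Section free_energy_cohomology.
Context {R : realType} {X : pmetricType R} (T : X -> X).

Lemma borel_measurable_continuous (u : X -> R) :
  continuous u -> measurable_fun [set: borel X] (u : borel X -> R).
Proof.
move=> /continuousP uc.
apply: (measurability _ (measurable_realfun.RGenOpens.measurableE R)).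
move=> _ [_ [a [b ->] <-]]; rewrite setTI; apply: sub_sigma_algebra.
exact/uc/interval_open.
Qed.

Lemma borel_measurable_continuous_self :
  continuous T -> measurable_fun [set: borel X] (T : borel X -> borel X).
Proof.
move=> /continuousP Tc.
apply: (@measurability _ _ _ (borel X) _ _ (@open X) erefl).
move=> _ [A oA <-]; rewrite setTI; apply: sub_sigma_algebra; exact: Tc.
Qed.

Lemma borel_integrable_continuous (mu : probability (borel X) R) (u : X -> R) :
  compact [set: X] -> continuous u ->
  mu.-integrable [set: borel X] (EFin \o (u : borel X -> R)).
Proof.
move=> Xc uc; apply: measurable_bounded_integrable => //.
- by rewrite (le_lt_trans (probability_le1 _ _))// ltry.
- exact: borel_measurable_continuous.
- have [K _ uK] := compact_continuous_bounded Xc uc.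
  exists K; split; first exact: num_real.
  by move=> y Ky x _; exact: le_trans (uK x) (ltW Ky).
Qed.

Lemma integral_invariant (mu : probability (borel X) R) (u : X -> R) :
  compact [set: X] -> continuous T -> continuous u -> Defs.invariant T mu ->
  (\int[mu]_x (u (T x))%:E = \int[mu]_x (u x)%:E)%E.
Proof.
move=> Xc Tc uc muT.
have mT := borel_measurable_continuous_self Tc.
have := @integral_pushforward _ _ _ _ _ _ mT mu setT
  (EFin \o (u : borel X -> R)).
rewrite preimage_setT /= => <-//.
- apply: eq_measure_integral => A mA _.
  by rewrite /= /pushforward muT.
- exact: measurable_int (borel_integrable_continuous mu Xc uc).
- apply: (@borel_integrable_continuous mu (u \o T)) => // x.
  by apply: continuous_comp; [exact: Tc|exact: uc].
Qed.

Lemma free_energy_cohomologous (phi psi u : X -> R)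
    (mu : probability (borel X) R) :
  compact [set: X] -> continuous T -> continuous phi -> continuous u ->
  (forall p, psi p = phi p - u p + u (T p)) -> Defs.invariant T mu ->
  free_energy T psi mu = free_energy T phi mu.
Proof.
move=> Xc Tc phic uc psiE muT; rewrite /free_energy; congr (_ + _)%E.
have iu := borel_integrable_continuous mu Xc uc.
have iuT : mu.-integrable [set: borel X] (EFin \o (u \o T : borel X -> R)).
  apply: (@borel_integrable_continuous mu (u \o T)) => // x.
  by apply: continuous_comp; [exact: Tc|exact: uc].
have iphi := borel_integrable_continuous mu Xc phic.
transitivity (\int[mu]_x ((phi x)%:E - ((u x)%:E - (u (T x))%:E)))%E.
  by apply: eq_integral => x _; rewrite psiE -!EFinB opprB addrA addrAC.
rewrite (integralB _ iphi (integrableB _ iu iuT))//=.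
rewrite (integralB _ iu iuT)//= integral_invariant// subee ?sube0//.
by apply: integrable_fin_num.
Qed.

Lemma equilibrium_state_cohomologous (phi psi u : X -> R)
    (mu : probability (borel X) R) :
  compact [set: X] -> continuous T -> continuous phi -> continuous u ->
  (forall p, psi p = phi p - u p + u (T p)) ->
  equilibrium_state T phi mu <-> equilibrium_state T psi mu.
Proof.
move=> Xc Tc phic uc psiE.
have freeE eta : Defs.invariant T eta ->
    free_energy T psi eta = free_energy T phi eta.
  by move=> etaT; exact: free_energy_cohomologous psiE etaT.
have supE : [set free_energy T psi eta | eta in Defs.invariant T] =
            [set free_energy T phi eta | eta in Defs.invariant T].
  by apply: eq_imagel.
by rewrite /equilibrium_state supE; split=> -[muT]; rewrite freeE.
Qed.

End free_energy_cohomology.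

(** * Coboundaries from summable orbits *)

Lemma weierstrass_M_test (R : realType) (X : topologicalType)
    (a : nat -> X -> R) (m : nat -> R) :
  (forall j, continuous (a j)) -> (forall j x, `|a j x| <= m j) ->
  cvgn (series m) ->
  (forall x, cvgn (series (a ^~ x))) /\
  continuous (fun x => limn (series (a ^~ x))).
Proof.
move=> ac am mcvg.
have m_ge0 j (x : X) : 0 <= m j by exact: le_trans (am j x).
have acvg x : cvgn (series (a ^~ x)).
  apply: normed_cvg; apply: series_le_cvg mcvg => j /=.
  - exact: normr_ge0.
  - exact: m_ge0 x.
  - exact: am.
split=> //.
have tail n x : `|limn (series (a ^~ x)) - series (a ^~ x) n| <=
    limn (series m) - series m n.
  have cl : `|series (a ^~ x) k - series (a ^~ x) n| @[k --> \oo] -->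
      `|limn (series (a ^~ x)) - series (a ^~ x) n|.
    by apply: cvg_norm; apply: cvgB; [exact: acvg|exact: cvg_cst].
  have cr : series m k - series m n @[k --> \oo] -->
      limn (series m) - series m n.
    by apply: cvgB; [exact: mcvg|exact: cvg_cst].
  apply: ler_cvg_to cl cr _; near=> k.
  have nk : (n <= k)%N by near: k; exact: nbhs_infty_ge.
  rewrite !sub_series nk (le_trans (ler_norm_sum _ _ _))//.
  by apply: ler_sum.
have Snc n : continuous (fun x => series (a ^~ x) n).
  apply: continuous_big => [x|j _]; last exact: ac.
  exact: add_continuous.
apply: (@uniform_limit_continuous X R ((fun n x => series (a ^~ x) n) @ \oo)).
  by exists 0%N => // n _; exact: Snc.
move=> B /uniform_nbhs [E [entE EB]].
move: entE; rewrite -entourage_ballE => -[e /= e0 eE].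
have mtail : \forall n \near \oo, limn (series m) - series m n < e.
  have /cvgrPdist_lt /(_ _ e0) := mcvg; apply: filterS => n.
  by apply: le_lt_trans; exact: ler_norm.
apply: filterS mtail => n ne; apply: EB => x _; apply: eE => /=.
by rewrite /ball /= (le_lt_trans (tail n x)).
Unshelve. all: by end_near. Qed.

(** The transfer function is [u = sum_j psi \o T^j]: precomposing with [T] drops
    the term of index [0], which is [psi]. *)
Lemma coboundary_of_summable_orbit (R : realType) (X : topologicalType)
    (T : X -> X) (psi : X -> R) (m : nat -> R) :
  continuous T -> continuous psi ->
  (forall j x, `|psi (iter j T x)| <= m j) -> cvgn (series m) ->
  exists2 u : X -> R, continuous u & forall x, psi x = u x - u (T x).
Proof.
move=> Tc psic psim mcvg.
pose a j x := psi (iter j T x).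
have iterc j : continuous (iter j T).
  by elim: j => [|j IH] x //=; apply: continuous_comp; [exact: IH|exact: Tc].
have ac j : continuous (a j).
  by move=> x; apply: continuous_comp; [exact: iterc|exact: psic].
have [acvg uc] := weierstrass_M_test ac psim mcvg.
exists (fun x => limn (series (a ^~ x))) => // x.
have shift n : series (a ^~ (T x)) n = series (a ^~ x) n.+1 - psi x.
  rewrite /series /= big_nat_recl//= addrC addKr.
  by apply: eq_bigr => j _; rewrite /a -iterSr.
have -> : limn (series (a ^~ (T x))) = limn (series (a ^~ x)) - psi x.
  apply: cvg_lim => //.
  rewrite (_ : series _ = fun n => series (a ^~ x) n.+1 - psi x).
    apply: cvgB; last exact: cvg_cst.
    by rewrite (cvg_shiftS (series (a ^~ x))); exact: acvg.
  exact/funext.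
by rewrite opprB addrC subrK.
Qed.

(** * Holder potentials on skew products with contracted fibres *)

Lemma holder_implies_continuous (R : realType) (X : metricType R)
    (phi : X -> R) :
  holder_continuous phi -> continuous phi.
Proof.
move=> [C [alpha [alpha0 _ phiC]]] x; apply/cvgrPdist_lt => e e0.
have C1 : 0 < `|C| + 1 by rewrite ltr_wpDl.
(* [d] solves [(|C| + 1) * d `^ alpha = e]; the summand 1 keeps the divisor
   positive when [C = 0]. *)
pose d := (e / (`|C| + 1)) `^ alpha^-1.
have eC : 0 < e / (`|C| + 1) by rewrite divr_gt0.
have d0 : 0 < d by rewrite powR_gt0.
apply/nbhs_ballP; exists d => //= y; rewrite ballEmdist /= => xy.
apply: le_lt_trans (phiC x y) _.
apply: (@le_lt_trans _ _ ((`|C| + 1) * mdist x y `^ alpha)).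
  by rewrite ler_wpM2r ?powR_ge0// (le_trans (ler_norm C))// lerDl.
rewrite mulrC -ltr_pdivlMr//.
have := gt0_ltr_powR alpha0 _ _ xy.
rewrite -powRrM mulVf ?gt_eqF// powRr1 ?ltW//.
by apply; rewrite nnegrE ?mdist_ge0// ltW.
Qed.

Lemma holder_mdist (R : realType) (X : metricType R) (y0 : X) :
  holder_continuous (mdist ^~ y0 : X -> R).
Proof.
exists 1, 1; split=> // p q; rewrite mul1r powRr1 ?mdist_ge0//.
rewrite ler_norml lerBlDr lerNl opprB lerBlDr metric_triangle andbT.
by rewrite (metric_sym p q) metric_triangle.
Qed.

Lemma C1_local_diffeo_continuous (R : realType) (n : nat) (M : topologicalType)
    (A : @smooth_atlas R n M) (f : M -> M) :
  C1_local_diffeo A f -> continuous f.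
Proof.
move=> fA x; have [U [V [h [[_ Ux] _ _ _ [[fc _] _]]]]] := fA x.
exact: fc.
Qed.

Lemma mdist_prod (R : realType) (M N : metricType R) (p q : M * N) :
  mdist p q = Num.max (mdist p.1 q.1) (mdist p.2 q.2).
Proof. by []. Qed.

Section skew_products.
Context {R : realType} {M N : metricType R} (f : M -> M) (g : M * N -> N).
Let F := skew_product f g.

Lemma skew_product_continuous :
  continuous f -> continuous g -> continuous F.
Proof.
move=> fc gc p; apply: cvg_pair; last exact: gc.
by apply: continuous_comp; [exact: cvg_fst|exact: fc].
Qed.

Lemma skew_product_contracts (lambda : R) (y0 : N) (j : nat) (p : M * N) :
  0 <= lambda ->
  (forall x y1 y2, mdist (g (x, y1)) (g (x, y2)) <= lambda * mdist y1 y2) ->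
  (forall x, g (x, y0) = y0) ->
  mdist (iter j F p).2 y0 <= lambda ^+ j * mdist p.2 y0.
Proof.
move=> l0 gl gy0; elim: j => [|j IH]; first by rewrite mul1r.
rewrite iterS exprS -mulrA; apply: le_trans (ler_wpM2l l0 IH).
case: (iter j F p) => x y /=; rewrite -[X in mdist _ X](gy0 x); exact: gl.
Qed.

(** Projecting two points to the section [y = y0] does not increase their
    distance. *)
Lemma holder_section (phi : M * N -> R) (y0 : N) :
  holder_continuous phi -> holder_continuous (fun p : M * N => phi (p.1, y0)).
Proof.
move=> [C [alpha [alpha0 alpha1 phiC]]]; exists `|C|, alpha; split=> // p q.
apply: le_trans (phiC _ _) _; apply: (@le_trans _ _
  (`|C| * (mdist (p.1, y0) (q.1, y0) : R) `^ alpha)).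
  by rewrite ler_wpM2r ?powR_ge0 ?ler_norm.
rewrite ler_wpM2l// ge0_ler_powR ?nnegrE ?mdist_ge0 ?(ltW alpha0)//.
rewrite [leLHS]mdist_prod /= mdistxx max_l ?mdist_ge0//.
by rewrite mdist_prod le_max lexx.
Qed.

(** The bounding series is geometric of ratio [lambda `^ alpha < 1]; it starts
    from [|C| * D `^ alpha], where [D] bounds the distance to [y0] in [N]. *)
Lemma fibre_gap_summable (phi : M * N -> R) (lambda : R) (y0 : N) :
  holder_continuous phi -> compact [set: N] -> 0 < lambda -> lambda < 1 ->
  (forall x y1 y2, mdist (g (x, y1)) (g (x, y2)) <= lambda * mdist y1 y2) ->
  (forall x, g (x, y0) = y0) ->
  exists2 m : nat -> R, cvgn (series m) & forall j p,
    `|phi (iter j F p) - phi ((iter j F p).1, y0)| <= m j.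
Proof.
move=> [C [alpha [alpha0 alpha1 phiC]]] Nc l0 l1 gl gy0.
have dist_y0c := holder_implies_continuous (holder_mdist y0).
have [D D0 dD] := compact_continuous_bounded Nc dist_y0c.
exists (geometric (`|C| * D `^ alpha) (lambda `^ alpha)).
  apply: is_cvg_geometric_series; rewrite ger0_norm ?powR_ge0//.
  have := gt0_ltr_powR alpha0 _ _ l1; rewrite powR1; apply; rewrite nnegrE//.
  exact: ltW.
move=> j p; set q := iter j F p.
apply: le_trans (phiC _ _) _; rewrite /geometric /= -mulrA.
apply: (@le_trans _ _ (`|C| * (mdist q (q.1, y0) : R) `^ alpha)).
  by rewrite ler_wpM2r ?powR_ge0 ?ler_norm.
rewrite ler_wpM2l// -(powR_mulrn j (powR_ge0 _ _)) powRAC.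
rewrite powR_mulrn ?(ltW l0)//.
rewrite -powRM ?exprn_ge0 ?(ltW l0)// mulrC.
rewrite ge0_ler_powR ?nnegrE ?mdist_ge0 ?mulr_ge0 ?exprn_ge0
  ?(ltW l0, ltW alpha0)//.
rewrite mdist_prod /= mdistxx max_r ?mdist_ge0//.
apply: le_trans (skew_product_contracts j p (ltW l0) gl gy0) _.
by rewrite ler_wpM2l ?exprn_ge0 ?(ltW l0)// (le_trans (ler_norm _) (dD _)).
Qed.

End skew_products.

Theorem proposition5p1 (R : realType) (n : nat) (M N : pmetricType R)
    (A : @smooth_atlas R n M) (G : riemannian_tensor A)
    (dM : riemannian_distance G)
    (M_compact : compact [set: M]) (N_compact : compact [set: N])
    (f : M -> M) (g : M * N -> N)
    (f_local_diffeo : C1_local_diffeo A f) (g_continuous : continuous g)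
    (lambda : R) (lambda_gt0 : 0 < lambda) (lambda_lt1 : lambda < 1)
    (g_contracts : forall x y1 y2,
      mdist (g (x, y1)) (g (x, y2)) <= lambda * mdist y1 y2)
    (y0 : N) (g_fixes : forall x, g (x, y0) = y0)
    (phi : M * N -> R) (phi_holder : holder_continuous phi)
    (c : R) (c_gt0 : 0 < c) :
  let F := skew_product f g in
  exists phib : M * N -> R,
    [/\ holder_continuous phib,
        (forall x y y', phib (x, y) = phib (x, y')),
        homologous F phib phi,
        (hyperbolic_potential G f F c phi ->
         hyperbolic_potential G f F c phib) &
        pressure F phib = pressure F phi /\
        (forall mu : probability (borel (M * N)%type) R,
          equilibrium_state F phi mu <-> equilibrium_state F phib mu)].

Proof.
move=> F.
have fc := C1_local_diffeo_continuous f_local_diffeo.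
have Fc : continuous F by exact: skew_product_continuous.
have MNc : compact [set: M * N].
  by rewrite -setXTT; exact: compact_setX.
have phic := holder_implies_continuous phi_holder.
pose phib (p : M * N) := phi (p.1, y0).
have phib_holder : holder_continuous phib := holder_section y0 phi_holder.
have phibc := holder_implies_continuous phib_holder.
have [m mcvg gapm] := fibre_gap_summable f phi_holder N_compact
  lambda_gt0 lambda_lt1 g_contracts g_fixes.
have gapc : continuous (fun p => phi p - phib p).
  by move=> p; apply: cvgB; [exact: phic|exact: phibc].
have [u uc gapE] := coboundary_of_summable_orbit Fc gapc gapm mcvg.
have phibE p : phib p = phi p - u p + u (F p).
  have -> : phi p - u p + u (F p) = phi p - (u p - u (F p)) by ring.
  by rewrite -gapE subKr.
have [K K0 uK] := compact_continuous_bounded MNc uc.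
have pressE Lambda :
    relative_pressure F phib Lambda = relative_pressure F phi Lambda.
  exact: relative_pressure_cohomologous K0 phibE uK.
exists phib; split.
- exact: phib_holder.
- by [].
- by exists u.
- move=> [_ lt_pressure eq_pressure]; split; first exact: phibc.
  + by rewrite !pressE; exact: lt_pressure.
  + by rewrite pressE [RHS]pressE; exact: eq_pressure.
- split; first exact: pressE.
  by move=> mu; exact: equilibrium_state_cohomologous phibE.
Qed.
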